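(* Let $\sim$ be a prelambda congruence and let $A$ be a term. Then $\mathrm{NF}(A) \subseteq \mathrm{Ind}_\sim(A)$.
   Context: Let $\mathbb{V}$ be an infinite set whose elements are called variables. The set $\mathbb{T}$ of terms is the set of words inductively defined by: every variable $x$ is a term; if $A,B$ are terms then $[AB]$ is a term; if $x$ is a variable and $A$ a term then $[\lambda x A]$ is a term. Equality of terms is syntactic identity. We abbreviate $[AB]$ as $AB$ and $[\lambda x A]$ as $\lambda x A$. A binary relation $\sim$ on $\mathbb{T}$ is a congruence if it is reflexive, symmetric, transitive, and for all terms $A,B,C,D$ and every variable $x$: $A\sim B$ implies $\lambda x A \sim \lambda x B$, and $A\sim B$, $C \sim D$ imply $AC \sim BD$. A prelambda congruence is a congruence $\sim$ such that for all terms $A,B,D$ and all variables $x,y$: ($\beta_1$) $[\lambda x x]D \sim D$; ($\beta_2$) $[\lambda x y]D \sim y$ whenever $x\neq y$; ($\beta_3$) $[\lambda x[AB]]D \sim [[\lambda x A]D][[\lambda x B]D]$; ($\beta_4$) $[\lambda x[\lambda x A]]D \sim \lambda x A$; ($\beta_5$) if $x \neq y$ and $[\lambda y D]x \sim D$, then $[\lambda x[\lambda y A]]D \sim \lambda y[[\lambda x A]D]$. For a prelambda congruence $\sim$ and a term $A$, $\mathrm{Ind}_\sim(A) = \{x \in \mathbb{V} : [\lambda x A]z \sim A \text{ for some variable } z \text{ with } x \neq z\}$. The set $\mathrm{NF}(A)$ of variables not occurring free in $A$ is defined by induction: $\mathrm{NF}(x) = \mathbb{V}\setminus\{x\}$,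 $\mathrm{NF}(BC) = \mathrm{NF}(B)\cap \mathrm{NF}(C)$, $\mathrm{NF}(\lambda x B) = \mathrm{NF}(B) \cup \{x\}$. *)

(* Defs.v *)
From mathcomp Require Import all_boot.
From mathcomp Require Import boolp classical_sets functions cardinality.
From Stdlib Require Export RelationClasses.

Set Implicit Arguments.
Unset Strict Implicit.
Unset Printing Implicit Defensive.

Local Open Scope classical_set_scope.

(* Terms are not identified up to renaming of bound variables: equality of
   terms is Leibniz equality on this type, i.e. syntactic identity. *)
Inductive term (V : Type) : Type :=
  | Var of V
  | App of term V & term V
  | Lam of V & term V.

Record congruence (V : Type) (R : term V -> term V -> Prop) : Prop := {
  congr_equiv : Equivalence R;
  congr_lam : forall (x : V) (A B : term V), R A B -> R (Lam x A) (Lam x B);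
  congr_app : forall A B C D : term V,
    R A B -> R C D -> R (App A C) (App B D)
}.

Record prelambda_congruence (V : Type) (R : term V -> term V -> Prop) : Prop := {
  prelambda_congr : congruence R;
  beta1 : forall (x : V) (D : term V), R (App (Lam x (Var x)) D) D;
  beta2 : forall (x y : V) (D : term V), x <> y ->
    R (App (Lam x (Var y)) D) (Var y);
  beta3 : forall (x : V) (A B D : term V),
    R (App (Lam x (App A B)) D) (App (App (Lam x A) D) (App (Lam x B) D));
  beta4 : forall (x : V) (A D : term V),
    R (App (Lam x (Lam x A)) D) (Lam x A);
  beta5 : forall (x y : V) (A D : term V), x <> y ->
    R (App (Lam y D) (Var x)) D ->
    R (App (Lam x (Lam y A)) D) (Lam y (App (Lam x A) D))
}.

Definition Ind (V : Type) (R : term V -> term V -> Prop) (A : term V) : set V :=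
  [set x | exists z : V, x <> z /\ R (App (Lam x A) (Var z)) A].

Fixpoint NF (V : Type) (A : term V) : set V :=
  match A with
  | Var x => ~` [set x]
  | App B C => NF B `&` NF C
  | Lam x B => NF B `|` [set x]
  end.

(* Main.v *)
Require Import Defs.
From mathcomp Require Import all_boot.
From mathcomp Require Import boolp classical_sets functions cardinality.

Local Open Scope classical_set_scope.

(** By induction on [A], if [x] is not free in [A], then [[λx A]z ~ A] for every [z] that is not a
    binder of [A] ([NF_subst_nonbinder]): the beta rules push the substitution down to the
    variables, where [beta2] erases it. Since [A] has finitely many binders and [V] is infinite,
    such a [z] exists with [z <> x]. *)

Fixpoint binders {V : Type} (A : term V) : set V :=
  match A with
  | Var _ => set0
  | App B C => binders B `|` binders C
  | Lam x B => x |` binders B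
  end.

Lemma finite_binders {V : Type} (A : term V) : finite_set (binders A).
Proof.
elim: A => [x|B finB C finC|x B finB] /=; first exact: finite_set0.
- by rewrite finite_setU.
- by rewrite finite_setU; split=> //; exact: finite_set1.
Qed.

(* Keeping [z] away from the binders of [A] makes the side condition of [beta5]
   an instance of [beta2]; a single [z] then serves all subterms of [A]. *)
Lemma NF_subst_nonbinder {V : Type} (R : term V -> term V -> Prop)
    (hR : prelambda_congruence R) (A : term V) (x z : V) :
  NF A x -> ~ binders A z -> R (App (Lam x A) (Var z)) A.
Proof.
have [[equivR congL congA] _ b2 b3 b4 b5] := hR.
elim: A => [y|B IHB C IHC|y B IHB] /=.
- by move=> xNy _; apply: b2 => xy; exact: xNy.
- move=> [xB xC] /not_orP[zB zC].
  transitivity (App (App (Lam x B) (Var z)) (App (Lam x C) (Var z))).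
    exact: b3.
  by apply: congA; [exact: IHB | exact: IHC].
- move=> xNF /not_orP[zNy zB].
  (* If [x = y], then [x] may be free in [B] and the induction hypothesis is out of reach; [beta4]
     concludes directly. *)
  have [<-|xNy] := pselect (x = y); first exact: b4.
  transitivity (Lam y (App (Lam x B) (Var z))).
    by apply: b5 => //; apply: b2 => yz; exact: zNy.
  by apply: congL; apply: IHB => //; case: xNF.
Qed.

Theorem theorem4p5 (V : Type) (infV : infinite_set [set: V])
    (R : term V -> term V -> Prop) (hR : prelambda_congruence R) (A : term V) :
  NF A `<=` Ind R A.
Proof.
move=> x xNF.
have finF : finite_set (x |` binders A).
  by rewrite finite_setU; split; [exact: finite_set1 | exact: finite_binders].
have [z zF] : exists z, ~ (x |` binders A) z.
  apply: contrapT => /forallNP allF; apply: infV.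
  by apply: sub_finite_set finF => z _; exact: contrapT (allF z).
move/not_orP: zF => [zNx zB]; exists z; split; first by move=> xz; exact: zNx.
exact: NF_subst_nonbinder.
Qed.
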